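(* There is a universal constant $c>0$ such that the following holds. Let $\varepsilon\ge 0,\delta\ge 0$ with $\varepsilon+\delta<c$. Let $A$ be any $(\varepsilon,\delta)$-differentially private mechanism (with respect to user-level adjacency) whose output depends on the users' data only through the vector of summed counts $N=[N_1,\dots,N_k]$. Then \[ S^A_{m,\alpha,\varepsilon,\delta}=\Omega\left(\frac{k}{m\alpha^2}+\frac{k}{\alpha(\varepsilon+\delta)}\right). \]
   Context: Let $[k]=\{1,\dots,k\}$ and let $\Delta_k$ be the set of probability distributions on $[k]$. There are $s$ users; each user $u$ holds $m$ samples $X_1(u),\dots,X_m(u)$, and all $sm$ samples are i.i.d. from an unknown $p\in\Delta_k$. For a user $u$, $N_i(u)$ is the number of samples of user $u$ equal to $i$, and $N_i=\sum_u N_i(u)$. An algorithm $A$ maps the users' data to an estimate $\hat p^A\in\Delta_k$, possibly randomized. Two datasets are adjacent if they differ only in the data of a single user. $A$ is $(\varepsilon,\delta)$-differentially private if for all adjacent datasets $D,D'$ and all measurable sets $S$ of outputs, $\Pr[A(D)\in S]\le e^{\varepsilon}\Pr[A(D')\in S]+\delta$. Let $L(A,s,m,p)=\mathbb{E}\left[\sum_{i=1}^k|p_i-\hat p^A_i|\right]$, the expectation being over the samples and the algorithm's randomness. The user complexity is $S^A_{m,\alpha,\varepsilon,\delta}=\min\{s:\sup_{p\in\Delta_k}L(A,s,m,p)\le\alpha\}$. The constant in $\Omega$ is universal.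
   Formalization: The formal theorem assumes k ≥ 2 and 0 < α ≤ α0 for some universal constant α0 > 0; without these the bound fails, since S = 0 when k = 1 (the loss is always 0) and when α ≥ 2 (any estimate, even with no users, is accurate enough). *)

(* Defs.v *)
From HB Require Import structures.
From mathcomp Require Import all_boot all_order all_algebra.
From mathcomp Require Import all_classical all_reals all_analysis.
From mathcomp Require Import Rstruct Rstruct_topology.
Set Implicit Arguments. Unset Strict Implicit. Unset Printing Implicit Defensive.
Import Order.TTheory GRing.Theory Num.Theory.
Local Open Scope ring_scope.

Section UserLevelDP.
Variable R : realType.

(* A dataset: s users, each holding m samples in [k] = 'I_k. *)
Definition dataset (s m k : nat) := {ffun 'I_s -> {ffun 'I_m -> 'I_k}}.

Definition count_vec (s m k : nat) (D : dataset s m k) (i : 'I_k) : nat :=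
  (\sum_(u < s) \sum_(j < m) (D u j == i))%N.

Definition adjacent (s m k : nat) (D D' : dataset s m k) : Prop :=
  exists u : 'I_s, forall v : 'I_s, v != u -> D v = D' v.

Definition in_simplex (k : nat) (p : 'I_k -> R) : Prop :=
  (forall i, 0 <= p i) /\ \sum_(i < k) p i = 1.

Definition data_prob (s m k : nat) (p : 'I_k -> R) (D : dataset s m k) : R :=
  \prod_(u < s) \prod_(j < m) p (D u j).

Definition l1dist (k : nat) (p q : 'I_k -> R) : R :=
  \sum_(i < k) `|p i - q i|.

Definition mechanism (s m k : nat) (d : measure_display) (T : measurableType d) :=
  dataset s m k -> probability T R.

Definition is_DP (s m k : nat) (d : measure_display) (T : measurableType d)
    (A : mechanism s m k T) (eps delta : R) : Prop :=
  forall D D' : dataset s m k, adjacent D D' ->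
  forall S : set T, measurable S ->
    (A D S <= (expR eps)%:E * A D' S + delta%:E)%E.

Definition count_based (s m k : nat) (d : measure_display) (T : measurableType d)
    (A : mechanism s m k T) : Prop :=
  forall D D' : dataset s m k, (forall i, count_vec D i = count_vec D' i) ->
  forall S : set T, measurable S -> A D S = A D' S.

Definition exp_loss (s m k : nat) (d : measure_display) (T : measurableType d)
    (A : mechanism s m k T) (est : T -> 'I_k -> R) (p : 'I_k -> R) : \bar R :=
  (\sum_(D : dataset s m k)
     (data_prob p D)%:E * \int[A D]_t (l1dist p (est t))%:E)%E.

Definition measurable_est (k : nat) (d : measure_display) (T : measurableType d)
    (est : T -> 'I_k -> R) : Prop :=
  forall i : 'I_k, measurable_fun [set: T] (fun t => est t i).

End UserLevelDP.

(* Main.v *)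
Require Import Defs.
From HB Require Import structures.
From mathcomp Require Import all_boot all_order all_algebra.
From mathcomp Require Import all_classical all_reals all_analysis.
From mathcomp Require Import Rstruct Rstruct_topology.
From mathcomp Require Import measurable_realfun ring lra zify.
Set Implicit Arguments. Unset Strict Implicit. Unset Printing Implicit Defensive.
Import Order.TTheory GRing.Theory Num.Theory.
Local Open Scope ring_scope.

(* The lower bound is Assouad's method on perturbations of the uniform
   distribution: the letters are grouped in K = k./2 pairs, and in pair i the
   letter selected by v i has mass (1 + g) / (2 K), the other (1 - g) / (2 K),
   with g = 8 alpha. An accurate estimator has to guess most bits v i, so some
   pair of neighbouring bit vectors must be distinguishable.
   - Statistically: the Bhattacharyya coefficient of the two product measures
     is at least (1 - g^2 / K)^(s m), whence s m alpha^2 >> k.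
   - Privately: permuting samples across users preserves the counts, so a
     count-based private mechanism can move m samples, wherever they are, at the
     price of a single user. It is therefore (eps + delta)-Lipschitz in total
     variation with respect to (Hamming distance on samples) / m, rounded up.
     The natural coupling of the two product measures has expected Hamming
     distance s m g / K, whence (eps + delta) (1 + s g / K) >> 1. *)

(** * Rearranging samples across users *)

(** List [B] and then its complement, list [C] and then its complement, and match the two lists
    position by position: an element outside [C] has index at least [#|C| >= #|B|], so its image is
    outside [B]. *)
Lemma inj_compl_sub (T : finType) (B C : {set T}) : (#|B| <= #|C|)%N ->
  exists2 sigma : T -> T, injective sigma &
    forall x, x \notin C -> sigma x \notin B.
Proof.
move=> leBC; have [x0 _|T0] := pickP (@predT T); last first.
  by exists id => // x; have := T0 x.
pose l (A : {set T}) := enum A ++ enum (~: A).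
have lU A : uniq (l A).
  rewrite cat_uniq !enum_uniq /= andbT.
  by apply/hasPn => x; rewrite !mem_enum inE.
have lM A x : x \in l A by rewrite mem_cat !mem_enum inE orbN.
have lS A : size (l A) = #|T|.
  rewrite cardT; apply/perm_size/uniq_perm; rewrite ?enum_uniq // => x.
  by rewrite lM mem_enum.
exists (fun x => nth x0 (l B) (index x (l C))) => [x y /eqP|x xC].
  rewrite nth_uniq ?lS -?(lS C) ?index_mem ?lM ?lU // => /eqP e.
  by rewrite -(nth_index x0 (lM C x)) e nth_index ?lM.
have ltx : (index x (l C) < #|T|)%N by rewrite -(lS C) index_mem lM.
have gex : (#|B| <= index x (l C))%N.
  apply: leq_trans leBC _.
  by rewrite index_cat mem_enum (negbTE xC) cardE leq_addr.
rewrite nth_cat -cardE ltnNge gex /=.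
have := @mem_nth _ x0 (enum (~: B)) (index x (l C) - #|B|).
rewrite mem_enum inE; apply.
by rewrite -cardE ltn_subLR // cardsC.
Qed.

Section Counts.
Variables (s m k : nat).
Implicit Types D E : dataset s m k.

Definition diff_set D E : {set 'I_s * 'I_m} := [set x | D x.1 x.2 != E x.1 x.2].

Lemma diff_set0 D E : #|diff_set D E| = 0%N -> D = E.
Proof.
move/eqP; rewrite cards_eq0 => /eqP e0.
apply/ffunP => u; apply/ffunP => j; apply/eqP.
by have := finset.in_set0 (u, j); rewrite -e0 inE /= => /negbFE.
Qed.

Lemma count_vec_reindex D (sigma : 'I_s * 'I_m -> 'I_s * 'I_m) i :
  injective sigma ->
  count_vec [ffun u => [ffun j => D (sigma (u, j)).1 (sigma (u, j)).2]] i
  = count_vec D i.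
Proof.
move=> inj; rewrite /count_vec !pair_bigA /=.
rewrite [RHS](reindex_inj inj) /=.
by apply: eq_bigr => -[u j] _; rewrite !ffunE.
Qed.

(** One permutation, applied to both datasets, packs all differing samples into the block of a
    single user [u0]; afterwards only that user's data differ. [D <> E] guarantees that a user
    exists. *)
Lemma count_adjacent D E : (#|diff_set D E| <= m)%N -> D <> E ->
  exists D' E' : dataset s m k,
    [/\ Defs.adjacent D' E', (forall i, count_vec D' i = count_vec D i)
      & (forall i, count_vec E' i = count_vec E i)].
Proof.
move=> leB neq.
have [e0|[[u0 j0] _]] := set_0Vmem (diff_set D E).
  by case: neq; apply: diff_set0; rewrite e0 cards0.
pose C : {set 'I_s * 'I_m} := (finset.setX [set u0] [set: 'I_m])%SET.
have cC : #|C| = m by rewrite cardsX cards1 cardsT card_ord mul1n.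
have [|sigma inj sP] := @inj_compl_sub _ (diff_set D E) C; first by rewrite cC.
exists [ffun u => [ffun j => D (sigma (u, j)).1 (sigma (u, j)).2]].
exists [ffun u => [ffun j => E (sigma (u, j)).1 (sigma (u, j)).2]].
split=> [|i|i]; [|exact: count_vec_reindex..].
exists u0 => v vu; rewrite !ffunE; apply/ffunP => j; rewrite !ffunE; apply/eqP.
have := sP (v, j); rewrite !inE /= andbT => /(_ vu).
by rewrite negbK.
Qed.

End Counts.

Section Lipschitz.
Variables (R : realType) (s m k : nat).
Implicit Types D E : dataset s m k.

(** Changing up to [m] samples costs one [b] by [count_adjacent], so [n] differing samples cost [b]
    times [n / m] rounded up. *)
Lemma count_lipschitz (f : dataset s m k -> R) (b : R) : 0 <= b ->
  (forall D E, (forall i, count_vec D i = count_vec E i) -> f D = f E) ->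
  (forall D E, Defs.adjacent D E -> f D <= f E + b) ->
  forall D E, f D <= f E + b * (1 + #|diff_set D E|%:R / m%:R).
Proof.
move=> b0 fC fA.
have step D E : (#|diff_set D E| <= m)%N -> f D <= f E + b.
  move=> le; have [->|/eqP neq] := eqVneq D E; first by rewrite lerDl.
  have [D' [E' [adj cD cE]]] := count_adjacent le neq.
  by rewrite -(fC _ _ cD) -(fC _ _ cE); exact: fA.
have steps t D E : (#|diff_set D E| <= t * m)%N -> f D <= f E + b *+ t.
  elim: t D => [|t IH] D le.
    by rewrite mulr0n addr0 (@diff_set0 _ _ _ D E) //; apply/eqP; rewrite -leqn0.
  have [small|big] := leqP #|diff_set D E| m.
    apply: le_trans (step _ _ small) _; rewrite lerD2l.
    by rewrite mulrS lerDl mulrn_wge0.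
  have [B' B'B cB'] : exists2 B' : {set _}, B' \subset diff_set D E & #|B'| = m.
    have : (0 < #|[set B' : {set _} | B' \subset diff_set D E & #|B'| == m]|)%N.
      by rewrite cards_draws bin_gt0 ltnW.
    by case/card_gt0P => B'; rewrite inE => /andP[? /eqP]; exists B'.
  (* The intermediate dataset copies [E] on [m] of the differing positions, which leaves one block
     fewer. *)
  pose D1 : dataset s m k :=
    [ffun u => [ffun j => if (u, j) \in B' then E u j else D u j]].
  have h1 : (#|diff_set D D1| <= m)%N.
    rewrite -[leqRHS]cB'; apply/subset_leq_card/fintype.subsetP => -[u j].
    rewrite inE /= !ffunE.
    by case: ifP => //; rewrite eqxx.
  have h2 : (#|diff_set D1 E| <= t * m)%N.
    have : (#|diff_set D1 E| <= #|diff_set D E :\: B'|)%N.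
      apply/subset_leq_card/fintype.subsetP => -[u j]; rewrite !inE /= !ffunE.
      by case: ifP => //; rewrite eqxx.
    move/leq_trans; apply; rewrite cardsD (finset.setIidPr B'B) cB'.
    by rewrite leq_subLR -mulSn.
  apply: le_trans (step _ _ h1) _.
  by rewrite mulrS addrCA [leRHS]addrC lerD2r; exact: IH.
move=> D E; set n := #|_|.
(* For [d = 0] the premise forces [a = 0]; this covers [m = 0], where both divisions return 0. *)
have ceil (a d : nat) : (a <= s * d -> a <= (a %/ d).+1 * d)%N.
  have [->|d0 _] := posnP d; first by rewrite !muln0.
  by apply: ltnW; rewrite ltn_ceil.
have le : (n <= (n %/ m).+1 * m)%N.
  by apply: ceil; apply: leq_trans (max_card _) _; rewrite card_prod !card_ord.
apply: le_trans (steps _ _ _ le) _.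
rewrite lerD2l -[b *+ _]mulr_natr ler_wpM2l // -natr1 addrC lerD2l.
move: n {le} => n; have [->|m0] := posnP m; first by rewrite divn0 invr0 mulr0.
by rewrite ler_pdivlMr ?ltr0n // -natrM ler_nat leq_divM.
Qed.
End Lipschitz.

(** * Sums of products over datasets *)

Section Products.
Variables (R : realType) (s m k : nat).
Implicit Types (D E : dataset s m k) (p : 'I_k -> R).

(** [f] may depend on the position: for the marginals of a coupling, the other dataset is fixed and
    enters through [(u, j)]. *)
Lemma sum_dataset_prod (f : 'I_s -> 'I_m -> 'I_k -> R) :
  \sum_(D : dataset s m k) \prod_(u < s) \prod_(j < m) f u j (D u j)
  = \prod_(u < s) \prod_(j < m) \sum_x f u j x.
Proof.
transitivity (\prod_(u < s) \sum_(g : {ffun 'I_m -> 'I_k}) \prod_(j < m) f u j (g j)).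
  by rewrite bigA_distr_bigA.
by apply: eq_bigr => u _; rewrite bigA_distr_bigA.
Qed.

Lemma prod_const_samples (x : R) : \prod_(u < s) \prod_(j < m) x = x ^+ (s * m).
Proof. by rewrite !prodr_const !card_ord -exprM mulnC. Qed.

Lemma sum_data_prob p : \sum_x p x = 1 -> \sum_(D : dataset s m k) data_prob p D = 1.
Proof.
by move=> p1; rewrite (sum_dataset_prod (fun _ _ => p)) prod_const_samples p1 expr1n.
Qed.

Lemma data_prob_ge0 p D : (forall x, 0 <= p x) -> 0 <= data_prob p D.
Proof. by move=> p0; do 2 apply: prodr_ge0 => ? _. Qed.

Lemma card_diff_set D E :
  #|diff_set D E|%:R = \sum_(u < s) \sum_(j < m) (D u j != E u j)%:R :> R.
Proof.
rewrite pair_bigA /= -sum1_card natr_sum big_mkcond /=.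
by apply: eq_bigr => -[u j] _; rewrite inE /=; case: (_ != _).
Qed.

Lemma sum_delta (F : 'I_k -> R) a : \sum_x F x * (x == a)%:R = F a.
Proof.
rewrite (bigD1 a) //= eqxx mulr1 big1 ?addr0 // => x /negbTE ->.
by rewrite mulr0.
Qed.

(** Spreads a factor attached to one sample over all positions, so that sums over datasets still
    factor. *)
Lemma prod_if_single (x : R) u0 j0 :
  \prod_(u < s) \prod_(j < m) (if (u == u0) && (j == j0) then x else 1) = x.
Proof.
by rewrite pair_bigA /= -big_mkcond /= (big_pred1 (u0, j0)).
Qed.

End Products.

(** * Lower bounds for testing between two product measures *)

Lemma bernoulli_le (R : realType) (z : R) n : 0 <= z <= 1 -> 1 - n%:R * z <= (1 - z) ^+ n.
Proof.
move=> /andP[z0 z1]; elim: n => [|n IH]; first by rewrite mul0r subr0 expr0.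
rewrite exprS; apply: le_trans (ler_wpM2l _ IH); last lra.
have : 0 <= n%:R :> R by rewrite ler0n.
rewrite -natr1; nra.
Qed.

Section TwoPoint.
Variables (R : realType) (s m k : nat).
Implicit Types (D E : dataset s m k) (f : dataset s m k -> R).

(** [r] stands in for the geometric mean of [p] and [p'], which avoids square roots. A pointwise
    inequality, linear in the three product weights, is summed in place of Cauchy-Schwarz. *)
Lemma two_point_bhattacharyya (p p' r : 'I_k -> R) f :
  (forall x, 0 <= p x) -> (forall x, 0 <= p' x) -> (forall x, 0 <= r x) ->
  \sum_x p x = 1 -> \sum_x p' x = 1 -> (forall x, r x ^+ 2 <= p x * p' x) ->
  (forall D, 0 <= f D <= 1) ->
  2 * (\sum_x r x) ^+ (s * m) - 1 <=
  3 / 2 * (\sum_D data_prob p D * f D + \sum_D data_prob p' D * (1 - f D)).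
Proof.
move=> p0 p'0 r0 p1 p'1 rpp f01.
have point D : 2 * data_prob r D - (data_prob p D + data_prob p' D) / 2 <=
    3 / 2 * (data_prob p D * f D + data_prob p' D * (1 - f D)).
  have : data_prob r D ^+ 2 <= data_prob p D * data_prob p' D.
    rewrite /data_prob -prodrXl -big_split /=; apply: ler_prod => u _.
    rewrite sqr_ge0 /= -prodrXl -big_split /=; apply: ler_prod => j _.
    by rewrite sqr_ge0 rpp.
  have := data_prob_ge0 D p0; have := data_prob_ge0 D p'0.
  have := data_prob_ge0 D r0; have := f01 D.
  move: (data_prob r D) (data_prob p D) (data_prob p' D) (f D) => g x y t.
  move=> /andP[t0 t1] g0 y0 x0 gxy.
  (* It suffices that 2 g <= 2 (min x y) + (max x y) / 2, which is AM-GM. *)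
  have [xy|yx] := leP x y.
    have sq : 0 <= (2 * x - y / 2) ^+ 2 by exact: sqr_ge0.
    have : 2 * g <= 2 * x + y / 2.
      by rewrite -(@ler_pXn2r _ 2) ?nnegrE //; [nra|lra|lra].
    nra.
  have sq : 0 <= (2 * y - x / 2) ^+ 2 by exact: sqr_ge0.
  have : 2 * g <= 2 * y + x / 2.
    by rewrite -(@ler_pXn2r _ 2) ?nnegrE //; [nra|lra|lra].
  nra.
have : \sum_(D : dataset s m k)
      (2 * data_prob r D - (data_prob p D + data_prob p' D) / 2) <=
    \sum_D (3 / 2 * (data_prob p D * f D + data_prob p' D * (1 - f D))).
  by apply: ler_sum => D _; exact: point.
rewrite big_split /= sumrN -mulr_suml -!mulr_sumr !big_split /=.
have -> : \sum_(D : dataset s m k) data_prob r D = (\sum_x r x) ^+ (s * m).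
  by rewrite (sum_dataset_prod (fun _ _ => r)) prod_const_samples.
rewrite !sum_data_prob //.
lra.
Qed.

(** Under a coupling of the two data laws, the error sum is the expectation of [f D + (1 - f E)];
    the Lipschitz bound then costs only the expected Hamming distance. *)
Lemma two_point_coupling (c : 'I_k -> R) (tau b : R) (i j : 'I_k) f :
  (forall x, 0 <= c x) -> 0 <= tau -> i != j -> \sum_x c x + tau = 1 ->
  0 <= b -> (forall D E, f D <= f E + b * (1 + #|diff_set D E|%:R / m%:R)) ->
  1 - b * (1 + s%:R * tau) <=
  \sum_D data_prob (fun x => c x + tau * (x == i)%:R) D * f D +
  \sum_D data_prob (fun x => c x + tau * (x == j)%:R) D * (1 - f D).
Proof.
move=> c0 tau0 ij c1 b0 fL.
(* The coupling: both samples come from c, or they are (i, j), with probability tau. *)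
pose q x y : R := c x * (y == x)%:R + tau * (x == i)%:R * (y == j)%:R.
have q0 x y : 0 <= q x y by rewrite addr_ge0 // ?mulr_ge0.
have qr x : \sum_y q x y = c x + tau * (x == i)%:R.
  by rewrite big_split /= !(sum_delta (fun=> _)).
have qc y : \sum_x q x y = c y + tau * (y == j)%:R.
  rewrite big_split /=; congr (_ + _).
    by under eq_bigr do rewrite eq_sym; rewrite sum_delta.
  by under eq_bigr do rewrite mulrAC; rewrite (sum_delta (fun=> _)).
have qne : \sum_x \sum_y q x y * (x != y)%:R = tau.
  have e x y : q x y * (x != y)%:R = tau * (x == i)%:R * (y == j)%:R.
    rewrite /q; have [<-|xy] := eqVneq x y.
      rewrite mulr0; have [->|] := eqVneq x i; last by rewrite mulr0 mul0r.
      by rewrite (negbTE ij) mulr0.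
    by rewrite mulr0 add0r mulr1.
  under eq_bigr do under eq_bigr do rewrite e.
  under eq_bigr do rewrite (sum_delta (fun=> _)).
  by rewrite (sum_delta (fun=> _)).
pose Q D E := \prod_(u < s) \prod_(l < m) q (D u l) (E u l).
have Q0 D E : 0 <= Q D E by do 2 apply: prodr_ge0 => ? _.
have Qr D : \sum_E Q D E = data_prob (fun x => c x + tau * (x == i)%:R) D.
  rewrite (sum_dataset_prod (fun u l y => q (D u l) y)).
  by do 2 apply: eq_bigr => ? _.
have Qc E : \sum_D Q D E = data_prob (fun x => c x + tau * (x == j)%:R) E.
  rewrite (sum_dataset_prod (fun u l x => q x (E u l))).
  by do 2 apply: eq_bigr => ? _.
have pair_sum (g : 'I_s -> 'I_m -> 'I_k -> 'I_k -> R) :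
    \sum_(D : dataset s m k) \sum_(E : dataset s m k)
      \prod_(u < s) \prod_(l < m) g u l (D u l) (E u l) =
    \prod_(u < s) \prod_(l < m) \sum_x \sum_y g u l x y.
  rewrite -(sum_dataset_prod (fun u l x => \sum_y g u l x y)).
  by apply: eq_bigr => D _; rewrite -(sum_dataset_prod (fun u l y => g u l (D u l) y)).
have q1 : \sum_x \sum_y q x y = 1.
  by under eq_bigr do rewrite qr; rewrite big_split /= (sum_delta (fun=> _)).
have Q1 : \sum_D \sum_E Q D E = 1.
  by rewrite (pair_sum (fun _ _ => q)) prod_const_samples q1 expr1n.
(* By linearity it suffices to treat one position: its factor becomes the disagreement probability
   [tau], and all other factors sum to 1. *)
have Qdiff : \sum_D \sum_E Q D E * #|diff_set D E|%:R = (s * m)%:R * tau.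
  have single u0 l0 : \sum_D \sum_E Q D E * (D u0 l0 != E u0 l0)%:R = tau.
    rewrite -[RHS](prod_if_single _ u0 l0).
    transitivity (\prod_(u < s) \prod_(l < m) \sum_x \sum_y
      q x y * (if (u == u0) && (l == l0) then (x != y)%:R else 1)); last first.
      apply: eq_bigr => u _; apply: eq_bigr => l _.
      case: ifP => _; first exact: qne.
      by under eq_bigr do under eq_bigr do rewrite mulr1.
    rewrite -(pair_sum (fun u l x y =>
      q x y * (if (u == u0) && (l == l0) then (x != y)%:R else 1))).
    apply: eq_bigr => D _; apply: eq_bigr => E _.
    under [RHS]eq_bigr do rewrite big_split /=.
    rewrite big_split /=; congr (_ * _).
    rewrite -[LHS](prod_if_single _ u0 l0).
    by do 2 apply: eq_bigr => ? _; case: ifP => // /andP[/eqP-> /eqP->].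
  transitivity (\sum_(u < s) \sum_(l < m) \sum_D \sum_E Q D E * (D u l != E u l)%:R).
    rewrite [RHS]pair_bigA [RHS]exchange_big /=; apply: eq_bigr => D _.
    rewrite [RHS]exchange_big /=; apply: eq_bigr => E _.
    by rewrite card_diff_set pair_bigA mulr_sumr.
  under eq_bigr do under eq_bigr do rewrite single.
  by rewrite !sumr_const !card_ord -mulrnA mulr_natl mulnC.
have -> : \sum_D data_prob (fun x => c x + tau * (x == i)%:R) D * f D +
  \sum_D data_prob (fun x => c x + tau * (x == j)%:R) D * (1 - f D) =
  \sum_D \sum_E Q D E * (f D + (1 - f E)).
  under [X in _ = X]eq_bigr do under eq_bigr do rewrite mulrDr.
  under [X in _ = X]eq_bigr do rewrite big_split /=.
  rewrite big_split /=; congr (_ + _).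
    by apply: eq_bigr => D _; rewrite -mulr_suml Qr.
  by rewrite exchange_big /=; apply: eq_bigr => E _; rewrite -mulr_suml Qc.
apply: le_trans (_ : \sum_D \sum_E
  (Q D E * (1 - b) - b / m%:R * (Q D E * #|diff_set D E|%:R)) <= _).
  under eq_bigr do rewrite big_split /= -mulr_suml sumrN -mulr_sumr.
  rewrite big_split /= -mulr_suml sumrN -mulr_sumr Q1 Qdiff.
  have : m%:R^-1 * (s * m)%:R <= s%:R :> R.
    have [->|m0] := posnP m; first by rewrite invr0 mul0r.
    by rewrite natrM mulrCA mulVf ?mulr1 // pnatr_eq0 -lt0n.
  move=> h; have := ler_wpM2l (mulr_ge0 b0 tau0) h; lra.
apply: ler_sum => D _; apply: ler_sum => E _.
have := ler_wpM2l (Q0 D E) (fL E D).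
have -> : diff_set E D = diff_set D E.
  by apply/setP => x; rewrite !inE eq_sym.
lra.
Qed.
End TwoPoint.

(** * Averaging over the hypercube *)

Section Assouad.
Variables (R : realType) (K : nat).

Definition flip (i : 'I_K) (v : {ffun 'I_K -> bool}) : {ffun 'I_K -> bool} :=
  [ffun j => if j == i then ~~ v j else v j].

Lemma flipK i : involutive (flip i).
Proof.
by move=> v; apply/ffunP => j; rewrite !ffunE; case: eqP => // _; rewrite negbK.
Qed.

(** Summed over all [v], the terms [G i v] and [G i (flip i v)] contribute equally, since [flip i]
    is a bijection; hence the factor 2. *)
Lemma assouad_average (G : 'I_K -> {ffun 'I_K -> bool} -> R) (L B : R) :
  (forall i v, L <= G i v + G i (flip i v)) ->
  (forall v, \sum_i G i v <= B) -> K%:R * L <= 2 * B.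
Proof.
move=> GL GB; set N := #|{ffun 'I_K -> bool}|.
have N0 : 0 < N%:R :> R by rewrite ltr0n; apply/card_gt0P; exists [ffun=> true].
rewrite -(ler_pM2l N0).
apply: le_trans (_ : \sum_i \sum_v (G i v + G i (flip i v)) <= _).
  rewrite mulrCA mulr_natl -[X in _ *+ X]card_ord -sumr_const.
  apply: ler_sum => i _; rewrite mulr_natl -sumr_const.
  by apply: ler_sum => v _; exact: GL.
have -> : \sum_i \sum_v (G i v + G i (flip i v)) = 2 * \sum_v \sum_i G i v.
  rewrite [X in _ = 2 * X]exchange_big /= mulr_sumr; apply: eq_bigr => i _.
  have e : \sum_v G i (flip i v) = \sum_v G i v.
    by rewrite [RHS](reindex_inj (inv_inj (@flipK i))).
  by rewrite big_split /= e mulr_natl.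
rewrite mulrCA ler_pM2l // mulr_natl -sumr_const.
by apply: ler_sum => v _; exact: GB.
Qed.
End Assouad.

(** * Paired perturbations of the uniform distribution *)

Section HardInstance.
Variables (R : realType) (k : nat).
Local Notation K := k./2.
Implicit Types (i : 'I_K) (b : bool) (v : {ffun 'I_K -> bool}).

Fact cell_subproof i b : (i.*2 + b < k)%N.
Proof. by have := ltn_ord i; case: b; lia. Qed.

Definition cell i b : 'I_k := Ordinal (cell_subproof i b).

Lemma cell_eq i j b b' : (cell i b == cell j b') = (i == j) && (b == b').
Proof.
apply/eqP/andP => [[e]|[/eqP-> /eqP->]] //.
have eb : b = b' by case: b b' e => -[]; lia.
by split; last exact/eqP; apply/eqP/val_inj => /=; rewrite eb in e; lia.
Qed.

Variable g : R.
Hypothesis g01 : 0 <= g <= 1.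

(* For odd k the last letter has mass 0. *)
Definition hard_dist v (x : 'I_k) : R :=
  \sum_i ((x == cell i (v i))%:R * ((1 + g) / (2 * K%:R)) +
          (x == cell i (~~ v i))%:R * ((1 - g) / (2 * K%:R))).

Lemma pair_weights_ge0 : 0 <= (1 + g) / (2 * K%:R) /\ 0 <= (1 - g) / (2 * K%:R).
Proof.
have [g0 g1] := andP g01.
have K0 : 0 <= 2 * K%:R :> R by rewrite mulr_ge0.
split; apply: divr_ge0 => //.
  lra.
lra.
Qed.

Lemma hard_dist_ge0 v x : 0 <= hard_dist v x.
Proof.
have [? ?] := pair_weights_ge0; apply: sumr_ge0 => i _.
by apply: addr_ge0; exact: mulr_ge0.
Qed.

Lemma sum_hard_dist v : (0 < K)%N -> \sum_x hard_dist v x = 1.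
Proof.
move=> K0; have Kn0 : K%:R != 0 :> R by rewrite pnatr_eq0 -lt0n.
rewrite exchange_big /=.
under eq_bigr do rewrite big_split /=.
under eq_bigr do (under eq_bigr do rewrite mulrC;
  under [X in _ + X]eq_bigr do rewrite mulrC).
under eq_bigr do rewrite !(sum_delta (fun=> _)).
rewrite sumr_const card_ord -mulr_natl; field.
by rewrite Kn0.
Qed.

Lemma hard_dist_cell v i b :
  hard_dist v (cell i b) = (if b == v i then 1 + g else 1 - g) / (2 * K%:R).
Proof.
rewrite /hard_dist (bigD1 i) //= big1 ?addr0 => [|j /negbTE ji].
  rewrite !cell_eq eqxx /=.
  by case: b (v i) => -[]; rewrite !(mul0r, mul1r, addr0, add0r).
by rewrite !cell_eq eq_sym ji /= !mul0r addr0.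
Qed.

(** The two masses of a pair differ by [g / K], so by the triangle inequality a [q] that orders the
    pair wrongly loses at least [g / K] there. A tie in [q] is read as the bit [true]. *)
Lemma l1dist_hard_dist v (q : 'I_k -> R) : (0 < K)%N ->
  g / K%:R * \sum_i ((q (cell i true) < q (cell i false)) == v i)%:R
  <= l1dist (hard_dist v) q.
Proof.
move=> K0; have Kn0 : K%:R != 0 :> R by rewrite pnatr_eq0 -lt0n.
case/andP: g01 => g0 _.
pose F x := `|hard_dist v x - q x|.
apply: le_trans (_ : \sum_(y : 'I_K * bool) F (cell y.1 y.2) <= _); last first.
  rewrite /l1dist (bigID (mem ((fun y => cell y.1 y.2) @: [set: 'I_K * bool])%SET)) /=.
  rewrite big_imset /= => [|[i b] [j b'] _ _ /eqP]; last first.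
    by rewrite cell_eq /= => /andP[/eqP-> /eqP->].
  under [X in _ <= X + _]eq_bigl do rewrite inE.
  by rewrite lerDl sumr_ge0.
rewrite -(pair_bigA _ (fun i b => F (cell i b))) /= mulr_sumr.
apply: ler_sum => i _; rewrite big_bool /= /F.
case: eqP => [e|_]; last by rewrite mulr0 addr_ge0.
rewrite !hard_dist_cell mulr1.
have -> : g / K%:R = (1 + g) / (2 * K%:R) - (1 - g) / (2 * K%:R) by field; rewrite Kn0.
case: (v i) e => /= e.
  by case: (ler0P (_ - q (cell i true))); case: (ler0P (_ - q (cell i false))); lra.
move/negbT: e; rewrite -leNgt.
by case: (ler0P (_ - q (cell i true))); case: (ler0P (_ - q (cell i false))); lra.
Qed.

Section FlipPair.
Variables (v : {ffun 'I_K -> bool}) (i : 'I_K).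

(** The part of the distribution that flipping bit [i] leaves unchanged. *)
Definition others (x : 'I_k) : R :=
  \sum_(j < K | j != i) ((x == cell j (v j))%:R * ((1 + g) / (2 * K%:R)) +
          (x == cell j (~~ v j))%:R * ((1 - g) / (2 * K%:R))).

Lemma others_ge0 x : 0 <= others x.
Proof.
have [? ?] := pair_weights_ge0; apply: sumr_ge0 => j _.
by apply: addr_ge0; exact: mulr_ge0.
Qed.

Lemma hard_distE x : hard_dist v x = others x +
  ((x == cell i (v i))%:R * ((1 + g) / (2 * K%:R)) +
   (x == cell i (~~ v i))%:R * ((1 - g) / (2 * K%:R))).
Proof. by rewrite /hard_dist (bigD1 i) //= addrC. Qed.

Lemma hard_dist_flipE x : hard_dist (flip i v) x = others x +
  ((x == cell i (~~ v i))%:R * ((1 + g) / (2 * K%:R)) +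
   (x == cell i (v i))%:R * ((1 - g) / (2 * K%:R))).
Proof.
rewrite /hard_dist (bigD1 i) //= !ffunE eqxx negbK addrC; congr (_ + _).
by apply: eq_bigr => j /negbTE ji; rewrite !ffunE ji.
Qed.

End FlipPair.
End HardInstance.

(** * From an accurate private estimator to bit tests *)

Section Estimator.
Variables (R : realType) (s m k : nat) (d : measure_display) (T : measurableType d).
Variables (A : mechanism R s m k T) (est : T -> 'I_k -> R).
Hypothesis mest : measurable_est est.
Local Notation K := k./2.
Implicit Types (i : 'I_K) (v : {ffun 'I_K -> bool}).

(** The estimate guesses bit [i] wrongly. Since ties are read as [true], exactly one of [v] and
    [flip i v] is guessed wrongly, which makes the complement in [err_set_flip] exact. *)
Definition err_set v i : set T :=
  [set t | (est t (cell i true) < est t (cell i false)) == v i].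

Lemma measurable_err_set v i : measurable (err_set v i).
Proof.
have mlt : measurable_fun [set: T] (fun t => est t (cell i true) < est t (cell i false)).
  by apply: measurable_fun_ltr; exact: mest.
rewrite (_ : err_set v i =
  (fun t => est t (cell i true) < est t (cell i false)) @^-1` [set v i])%classic; last first.
  by apply/seteqP; split => t /eqP.
rewrite -[X in measurable X]setTI; exact: mlt.
Qed.

Lemma err_set_flip v i : err_set (flip i v) i = (~` err_set v i)%classic.
Proof.
apply/seteqP; split => t; rewrite /err_set /= ffunE eqxx.
  by case: (v i) (_ < _) => -[].
by move/negP; case: (v i) (_ < _) => -[].
Qed.

Definition err_prob v i D : R := fine (A D (err_set v i)).

Lemma err_probE v i D : A D (err_set v i) = (err_prob v i D)%:E.
Proof.
rewrite /err_prob fineK //; apply: fin_num_measure; exact: measurable_err_set.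
Qed.

Lemma err_prob01 v i D : 0 <= err_prob v i D <= 1.
Proof.
rewrite -!lee_fin -err_probE measure_ge0 /=.
exact: probability_le1 (measurable_err_set v i).
Qed.

Lemma err_prob_flip v i D : err_prob (flip i v) i D = 1 - err_prob v i D.
Proof.
apply: EFin_inj; rewrite -err_probE err_set_flip probability_setC.
  by rewrite err_probE.
exact: measurable_err_set.
Qed.

Lemma exp_loss_hard_dist (g : R) v : 0 <= g <= 1 -> (0 < K)%N ->
  ((g / K%:R * \sum_i \sum_D data_prob (hard_dist g v) D * err_prob v i D)%:E
   <= exp_loss A est (hard_dist g v))%E.
Proof.
move=> g01 K0; have [g0 _] := andP g01.
have gK0 : 0 <= g / K%:R by rewrite divr_ge0.
rewrite exchange_big /= mulr_sumr -sumEFin; apply: lee_sum => D _.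
rewrite -mulr_sumr mulrCA EFinM.
apply: lee_wpmul2l.
  by rewrite lee_fin; apply: data_prob_ge0 => x; exact: hard_dist_ge0.
have mi i : measurable_fun [set: T] (EFin \o (\1_(err_set v i) : T -> R)).
  by apply/measurable_EFinP; apply: measurable_indic; exact: measurable_err_set.
have -> : (g / K%:R * \sum_i err_prob v i D)%:E =
    (\int[A D]_t ((g / K%:R)%:E * \sum_i (\1_(err_set v i) t)%:E))%E.
  rewrite ge0_integralZl_EFin //.
  - rewrite ge0_integral_sum //.
    rewrite EFinM -sumEFin; congr (_ * _)%E; apply: eq_bigr => i _.
    rewrite -err_probE integral_indic //; last exact: measurable_err_set.
    by rewrite classical_sets.setIT.
  - by move=> t _; apply: sume_ge0 => i _; rewrite lee_fin.
  - exact: emeasurable_sum.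
apply: ge0_le_integral => //.
- by move=> t _; rewrite mule_ge0 ?lee_fin //; apply: sume_ge0 => i _; rewrite lee_fin.
- by apply: measurable_funeM; exact: emeasurable_sum.
- apply/measurable_EFinP; apply: measurable_sum => x.
  apply: measurableT_comp => //; apply: measurable_funB => //; exact: mest.
move=> t _; rewrite sumEFin -EFinM lee_fin.
apply: le_trans (l1dist_hard_dist g01 v (est t) K0).
rewrite ler_wpM2l //; apply: ler_sum => i _.
rewrite indicE; case: (boolP (_ \in _)) => //=; rewrite inE /err_set /= => ->.
by [].
Qed.

Lemma err_prob_lipschitz (eps delta : R) v i : 0 <= eps -> 0 <= delta ->
  is_DP A eps delta -> count_based A ->
  forall D E, err_prob v i D <=
    err_prob v i E + (eps + delta) * (1 + #|diff_set D E|%:R / m%:R).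
Proof.
move=> e0 d0 dpA cA; apply: count_lipschitz; first exact: addr_ge0.
  by move=> D E /cA e; rewrite /err_prob e //; exact: measurable_err_set.
move=> D E /dpA /(_ _ (measurable_err_set v i)).
rewrite !err_probE -EFinM -EFinD lee_fin => le.
have /andP[x0 x1] := err_prob01 v i D; have /andP[y0 y1] := err_prob01 v i E.
move: (err_prob v i D) (err_prob v i E) x0 x1 y0 y1 le => x y x0 x1 y0 y1 le.
(* The other case has [x - delta > 0], so it may multiply the lower bound on [expR (- eps)]. *)
have [xd|xd] := leP x delta; first by lra.
have : expR (- eps) * (x - delta) <= y.
  rewrite expRN mulrC ler_pdivrMr ?expR_gt0 //.
  by rewrite [y * _]mulrC; lra.
(* Since x <= 1, the factor exp (- eps) >= 1 - eps costs at most eps. *)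
have := expR_ge1Dx (- eps); nra.
Qed.

(** * The two lower bounds *)

Section Bounds.
Variables (alpha : R).
Hypotheses (alpha0 : 0 < alpha) (alpha8 : alpha <= 8^-1) (k2 : (2 <= k)%N).
Hypothesis accurate : forall p, in_simplex p -> (exp_loss A est p <= alpha%:E)%E.

Let g := 8 * alpha.

Let g01 : 0 <= g <= 1.
Proof.
rewrite /g; apply/andP; split.
  by move: alpha0; lra.
by move: alpha8; lra.
Qed.

Let K0 : (0 < K)%N. Proof. by lia. Qed.

(** Loss at most [alpha] with [g = 8 * alpha] allows at most [K / 8] expected wrong bits, and
    averaging doubles this to [L <= 2 / 8]. *)
Lemma pairwise_error_le (L : R) :
  (forall i v, L <= \sum_D data_prob (hard_dist g v) D * err_prob v i D +
     \sum_D data_prob (hard_dist g (flip i v)) D * (1 - err_prob v i D)) ->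
  L <= 4^-1.
Proof.
move=> hL; have Kp : 0 < K%:R :> R by rewrite ltr0n.
pose G i v := \sum_D data_prob (hard_dist g v) D * err_prob v i D.
have GL i v : L <= G i v + G i (flip i v).
  apply: le_trans (hL i v) _; rewrite lerD2l /G.
  by under [leRHS]eq_bigr do rewrite err_prob_flip.
have GB v : \sum_i G i v <= K%:R / 8.
  have simp : in_simplex (hard_dist g v).
    by split; [exact: hard_dist_ge0|exact: sum_hard_dist].
  have := le_trans (exp_loss_hard_dist v g01 K0) (accurate simp).
  rewrite lee_fin /g mulrAC ler_pdivrMr // => h.
  by rewrite -(ler_pM2l alpha0) -(@ler_pM2l _ 8) //; lra.
have := assouad_average GL GB; nra.
Qed.

Lemma sample_lower_bound : 5 * K%:R <= 1024 * ((s * m)%:R * alpha ^+ 2).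
Proof.
have Kp : 0 < K%:R :> R by rewrite ltr0n.
have K1 : 1 <= K%:R :> R by rewrite ler1n.
have [g0 g1] := andP g01.
pose z := g ^+ 2 / K%:R.
have z01 : 0 <= z <= 1.
  apply/andP; split; first by rewrite divr_ge0 ?sqr_ge0.
  by rewrite ler_pdivrMr // mul1r; nra.
(* Pair [i] has mass [1 / K], of which [r] loses the fraction [g ^+ 2]; hence [r] sums to [1 - z],
   and Bernoulli's inequality linearizes its power. *)
have : (2 * (1 - (s * m)%:R * z) - 1) * (2 / 3) <= 4^-1.
  apply: pairwise_error_le => i v.
  (* r is a lower bound for sqrt (p * p'), as 1 - g^2 <= sqrt (1 - g^2). *)
  pose rho := (1 - g ^+ 2) / (2 * K%:R).
  pose r x := others g v i x +
    ((x == cell i (v i))%:R * rho + (x == cell i (~~ v i))%:R * rho).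
  have rho0 : 0 <= rho by rewrite divr_ge0 //; nra.
  have delta a (w : R) : \sum_(x < k) (x == a)%:R * w = w.
    by under eq_bigr do rewrite mulrC; rewrite (sum_delta (fun=> w)).
  have sr : \sum_x r x = 1 - z.
    have := sum_hard_dist g v K0; under eq_bigr do rewrite (hard_distE g v i).
    rewrite !big_split /= !delta => <-.
    by rewrite /rho /z; field; rewrite gt_eqF.
  have rr x : r x ^+ 2 <= hard_dist g v x * hard_dist g (flip i v) x.
    rewrite hard_dist_flipE (hard_distE g v i) /r.
    have := others_ge0 g01 v i x; move: (others g v i x) => c c0.
    have ne : cell i (v i) != cell i (~~ v i) by rewrite cell_eq eqxx; case: (v i).
    have rhoE : rho = (1 - g ^+ 2) * (2 * K%:R)^-1 by [].
    have W0 : 0 <= (2 * K%:R)^-1 :> R by rewrite invr_ge0 mulr_ge0.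
    move: (2 * K%:R)^-1 rhoE W0 => W -> W0.
    (* The right side exceeds the left by [2 * c * W * g ^+ 2 + W ^+ 2 * ((1 - g ^+ 2) * g ^+
       2)]. *)
    have key : (c + (1 - g ^+ 2) * W) ^+ 2 <= (c + (1 + g) * W) * (c + (1 - g) * W).
      have : 0 <= c * W * g ^+ 2 by apply: mulr_ge0 (sqr_ge0 _); exact: mulr_ge0.
      have g21 : 0 <= 1 - g ^+ 2 by nra.
      have : 0 <= W ^+ 2 * ((1 - g ^+ 2) * g ^+ 2).
        by apply: mulr_ge0 (sqr_ge0 _) _; apply: mulr_ge0 (sqr_ge0 _).
      lra.
    have [->|_] := eqVneq x (cell i (v i)).
      by rewrite (negbTE ne) !mul1r !mul0r !addr0 !add0r.
    have [_|_] := eqVneq x (cell i (~~ v i)).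
      by rewrite !mul1r !mul0r !addr0 !add0r [leRHS]mulrC.
    by rewrite !mul0r !addr0 expr2.
  have r0 x : 0 <= r x.
    by apply: addr_ge0; [exact: others_ge0|apply: addr_ge0; exact: mulr_ge0].
  have := two_point_bhattacharyya (hard_dist_ge0 g01 v) (hard_dist_ge0 g01 (flip i v))
    r0 (sum_hard_dist g v K0) (sum_hard_dist g (flip i v) K0) rr (err_prob01 v i).
  have := bernoulli_le (s * m) z01; rewrite sr.
  lra.
have -> : (s * m)%:R * z = 64 * ((s * m)%:R * alpha ^+ 2) / K%:R.
  by rewrite /z /g; field; rewrite gt_eqF.
set y := _ * alpha ^+ 2 => h.
have : 5 / 16 <= 64 * y / K%:R by lra.
by rewrite ler_pdivlMr //; lra.
Qed.

Lemma user_lower_bound (eps delta : R) : 0 <= eps -> 0 <= delta ->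
  eps + delta < 4^-1 -> is_DP A eps delta -> count_based A ->
  K%:R <= 16 * (s%:R * alpha * (eps + delta)).
Proof.
move=> e0 d0 ed dpA cA.
have Kp : 0 < K%:R :> R by rewrite ltr0n.
have [g0 g1] := andP g01.
have : 1 - (eps + delta) * (1 + s%:R * (g / K%:R)) <= 4^-1.
  apply: pairwise_error_le => i v.
  (* The common part [c] gives both letters of the pair the smaller weight; the excess [g / K] sits
     on one letter and moves to the other under [flip i]. *)
  pose kappa := (1 - g) / (2 * K%:R).
  pose c x := others g v i x +
    ((x == cell i (v i))%:R * kappa + (x == cell i (~~ v i))%:R * kappa).
  have c0 x : 0 <= c x.
    apply: addr_ge0; first exact: others_ge0.
    by apply: addr_ge0; apply: mulr_ge0 => //; case: (pair_weights_ge0 k g01).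
  have pE x : hard_dist g v x = c x + g / K%:R * (x == cell i (v i))%:R.
    by rewrite (hard_distE g v i) /c /kappa; field; rewrite gt_eqF.
  have p'E x : hard_dist g (flip i v) x = c x + g / K%:R * (x == cell i (~~ v i))%:R.
    by rewrite hard_dist_flipE /c /kappa; field; rewrite gt_eqF.
  have gK0 : 0 <= g / K%:R by rewrite divr_ge0.
  have ne : cell i (v i) != cell i (~~ v i) by rewrite cell_eq eqxx; case: (v i).
  have c1 : \sum_x c x + g / K%:R = 1.
    rewrite -[RHS](sum_hard_dist g v K0); under [RHS]eq_bigr do rewrite pE.
    by rewrite [RHS]big_split /= (sum_delta (fun=> _)).
  have := two_point_coupling c0 gK0 ne c1 (addr_ge0 e0 d0)
    (err_prob_lipschitz v i e0 d0 dpA cA).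
  by rewrite -(funext pE) -(funext p'E).
have -> : s%:R * (g / K%:R) = 8 * (s%:R * alpha) / K%:R.
  by rewrite /g; field; rewrite gt_eqF.
set b := eps + delta in ed *; set w := s%:R * alpha => h.
(* From [h], [b * (1 + 8 * w / K) >= 3 / 4], and [b < 1 / 4] leaves more than one half. *)
have : 2^-1 <= 8 * (w * b) / K%:R by lra.
by rewrite ler_pdivlMr //; lra.
Qed.

End Bounds.
End Estimator.

(** * Combining the two bounds *)

Theorem theorem1 :
  exists c : Rdefinitions.R, 0 < c /\
  exists C : Rdefinitions.R, 0 < C /\
  exists alpha0 : Rdefinitions.R, 0 < alpha0 /\
  forall (k m s : nat) (eps delta alpha : Rdefinitions.R),
    (2 <= k)%N -> 0 <= eps -> 0 <= delta -> eps + delta < c ->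
    0 < alpha -> alpha <= alpha0 ->
  forall (d : measure_display) (T : measurableType d)
         (A : @mechanism Rdefinitions.R s m k d T) (est : T -> 'I_k -> Rdefinitions.R),
    (forall t, in_simplex (est t)) ->
    measurable_est est ->
    is_DP A eps delta ->
    count_based A ->
    (forall p : 'I_k -> Rdefinitions.R, in_simplex p ->
       (exp_loss A est p <= alpha%:E)%E) ->
    C * k%:R <= s%:R * m%:R * alpha ^+ 2 /\
    C * k%:R <= s%:R * alpha * (eps + delta).
Proof.
(* [4^-1] is the threshold of [user_lower_bound], and [8^-1] ensures [g <= 1]. With [k <= 3 * K] the
   bounds lose factors [3 * 1024 / 5] and [3 * 16], both below 768. *)
exists 4^-1; split; first lra.
exists 768^-1; split; first lra.
exists 8^-1; split; first lra.
move=> k m s eps delta alpha k2 e0 d0 ed a0 a8 d T A est _ mest dpA cA acc.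
have k3 : k%:R <= 3 * k./2%:R :> Rdefinitions.R by rewrite -natrM ler_nat; lia.
have := sample_lower_bound mest a0 a8 k2 acc.
have := user_lower_bound mest a0 a8 k2 acc e0 d0 ed dpA cA.
rewrite natrM => h1 h2.
have k0 : 0 <= k%:R :> Rdefinitions.R by [].
split; lra.
Qed.
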